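(* Let $(\mathcal{S},\mathcal{A},\boldsymbol{r},\mathcal{U},\boldsymbol{p}_0)$ be a robust MDP with a definable compact sa-rectangular uncertainty set $\mathcal{U}$. Let $(\omega_t)_{t\ge0}$ be a (strictly) increasing sequence of nonnegative reals with $\lim_{t\to+\infty}\omega_t=+\infty$ and $\lim_{t\to+\infty}\omega_t/\omega_{t+1}=1$, and set $\gamma_t=\omega_t/\omega_{t+1}$ for $t\in\mathbb{N}$; assume that the sequence of discount factors is increasing: $\gamma_t\le\gamma_{t+1}$ for all $t\in\mathbb{N}$. Define $\boldsymbol{v}^0=\boldsymbol{0}\in\mathbb{R}^{\mathcal{S}}$ and, for $t\in\mathbb{N}$, $$v^{t+1}_s=\max_{a\in\mathcal{A}}\ \min_{\boldsymbol{p}_{sa}\in\mathcal{U}_{sa}}\boldsymbol{p}_{sa}^\top\big((1-\gamma_t)\boldsymbol{r}_{sa}+\gamma_t\boldsymbol{v}^t\big),\qquad\forall\,s\in\mathcal{S}.$$ Then $(\boldsymbol{v}^t)_{t\ge1}$ converges to $\boldsymbol{g}^\star\in\mathbb{R}^{\mathcal{S}}$.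
   Context: A robust MDP (RMDP) is a tuple $(\mathcal{S},\mathcal{A},\boldsymbol{r},\mathcal{U},\boldsymbol{p}_0)$: $\mathcal{S}$ (states) and $\mathcal{A}$ (actions) are finite nonempty sets, $\boldsymbol{r}\in\mathbb{R}^{\mathcal{S}\times\mathcal{A}\times\mathcal{S}}$ is the reward function (with $\boldsymbol{r}_{sa}=(r_{sas'})_{s'\in\mathcal{S}}$), the uncertainty set $\mathcal{U}\subset\Delta(\mathcal{S})^{\mathcal{S}\times\mathcal{A}}$ is a nonempty compact set of transition probabilities $\boldsymbol{P}=(\boldsymbol{p}_{sa})_{s,a}$, and $\boldsymbol{p}_0\in\Delta(\mathcal{S})$ is the initial distribution. The set $\mathcal{U}$ is sa-rectangular if $\mathcal{U}=\prod_{(s,a)}\mathcal{U}_{sa}$ with $\mathcal{U}_{sa}\subseteq\Delta(\mathcal{S})$. Definability (in the real exponential field): a subset of $\mathbb{R}^n$ is definable if it is the image, under a canonical projection $\mathbb{R}^{n+k}\to\mathbb{R}^n$ eliminating some set of $k$ variables, of a set of the form $\{\boldsymbol{x}\in\mathbb{R}^{n+k}: Q(x_1,\dots,x_{n+k},\exp(x_1),\dots,\exp(x_{n+k}))=0\}$ with $Q$ a real polynomial in $2(n+k)$ variables. $\mathcal{U}$ is viewed as a subset of $\mathbb{R}^{\mathcal{S}\times\mathcal{A}\times\mathcal{S}}$. The optimal gain $\boldsymbol{g}^\star\in\mathbb{R}^{\mathcal{S}}$ is $$g^\star_s=\max_{\pi\in\Pi_{\sf SD}}\ \inf_{\boldsymbol{P}\in\mathcal{U}}\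 \lim_{T\to+\infty}\mathbb{E}_{\pi,\boldsymbol{P}}\Big[\tfrac{1}{T+1}\sum_{t=0}^{T}r_{s_ta_ts_{t+1}}\ \Big|\ s_0=s\Big],\quad s\in\mathcal{S},$$ where $\Pi_{\sf SD}$ is the set of stationary deterministic policies $\mathcal{S}\to\mathcal{A}$ and $\mathbb{E}_{\pi,\boldsymbol{P}}$ is expectation with respect to the law of $(s_t,a_t)_{t\ge0}$ induced by $\pi$ and $\boldsymbol{P}$. *)

(* Defs.v *)
From mathcomp Require Import all_boot all_order all_algebra.
From mathcomp Require Import all_classical all_reals all_analysis.
(* Not imported: the notations of mpoly clash with those of mathcomp-analysis. *)
From mathcomp Require mpoly.

Set Implicit Arguments.
Unset Strict Implicit.
Unset Printing Implicit Defensive.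

Import Order.TTheory GRing.Theory Num.Theory numFieldNormedType.Exports.

Local Open Scope classical_set_scope.
Local Open Scope ring_scope.

Definition simplex (R : realType) (S : finType) : set (S -> R) :=
  [set p | (forall s, 0 <= p s) /\ \sum_s p s = 1].

(* Zero sets of Q(x_1, .., x_m, exp x_1, .., exp x_m). *)
Definition exp_zero_set (R : realType) (m : nat)
    (Q : mpoly.mpoly (m + m) R) : set 'rV[R]_m :=
  [set x | mpoly.meval (row_mx x (map_mx expR x) 0) Q = 0].

(* A canonical projection eliminating k of the n + k variables is given by the
   strictly increasing map [keep] that lists the n variables that remain. *)
Definition exp_definable (R : realType) (n : nat) (X : set 'rV[R]_n) : Prop :=
  exists (k : nat) (keep : 'I_n -> 'I_(n + k))
         (Q : mpoly.mpoly ((n + k) + (n + k)) R),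
    (forall i j : 'I_n, (i < j)%N -> (keep i < keep j)%N) /\
    X = [set \row_i x 0 (keep i) | x in exp_zero_set Q].

Definition transition (R : realType) (S A : finType) : Type := S -> A -> S -> R.

(* Identification of R^(S x A x S) with R^n for n = |S x A x S|. *)
Definition coords (R : realType) (S A : finType) (P : transition R S A) :
    'rV[R]_#|{: S * A * S}| :=
  \row_i P (enum_val i).1.1 (enum_val i).1.2 (enum_val i).2.

Record rmdp (R : realType) (S A : finType) : Type := RMDP {
  reward : S -> A -> S -> R;
  uncertainty : set (transition R S A);
  initial : S -> R;
  states_nonempty : (0 < #|S|)%N;
  actions_nonempty : (0 < #|A|)%N;
  uncertainty_stochastic :
    forall P, uncertainty P -> forall s a, simplex (P s a);
  uncertainty_nonempty : uncertainty !=set0;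
  uncertainty_compact : compact (@coords R S A @` uncertainty);
  initial_stochastic : simplex initial }.

Definition sa_rectangular (R : realType) (S A : finType)
    (U : set (transition R S A)) (Usa : S -> A -> set (S -> R)) : Prop :=
  (forall s a, Usa s a `<=` @simplex R S) /\
  U = [set P | forall s a, Usa s a (P s a)].

Section OptimalGain.
Variables (R : realType) (S A : finType).
Implicit Types (M : rmdp R S A) (pi : {ffun S -> A}) (P : transition R S A).

(* Law of (s_0, a_0), .., (s_n, a_n) under pi and P, given s_0 = s. *)
Definition path_prob pi P (s : S) (n : nat) (h : {ffun 'I_n.+1 -> S * A}) : R :=
  ((h ord0).1 == s)%:R *
  (\prod_(t < n.+1) ((h t).2 == pi (h t).1)%:R) *
  (\prod_(t < n) P (h (widen_ord (leqnSn n) t)).1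
                   (h (widen_ord (leqnSn n) t)).2
                   (h (lift ord0 t)).1).

Definition average_reward M (T : nat) (h : {ffun 'I_T.+2 -> S * A}) : R :=
  (T.+1)%:R^-1 *
  \sum_(t < T.+1) reward M (h (widen_ord (leqnSn T.+1) t)).1
                           (h (widen_ord (leqnSn T.+1) t)).2
                           (h (lift ord0 t)).1.

(* The averaged reward at horizon T only depends on (s_t, a_t) for t <= T + 1,
   so its expectation is a finite sum. *)
Definition expected_average_reward M pi P (s : S) (T : nat) : R :=
  \sum_(h : {ffun 'I_T.+2 -> S * A}) path_prob pi P s h * average_reward M h.

(* For a stochastic P the limit exists, as a Cesaro limit of powers of a
   stochastic matrix. *)
Definition long_run_average M pi P (s : S) : R :=
  limn (expected_average_reward M pi P s).

(* The sup is a maximum, over the finite nonempty set of policies; the inf is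
   over a nonempty set of reals bounded by the largest absolute reward. *)
Definition optimal_gain M (s : S) : R :=
  sup (range (fun pi : {ffun S -> A} =>
    inf [set long_run_average M pi P s | P in uncertainty M])).

End OptimalGain.

(* The sup over the finite nonempty set A and the inf over the compact nonempty
   set Usa s a are both attained. *)
Definition robust_bellman (R : realType) (S A : finType) (M : rmdp R S A)
    (Usa : S -> A -> set (S -> R)) (gamma : R) (v : S -> R) (s : S) : R :=
  sup (range (fun a : A =>
    inf [set \sum_s' p s' * ((1 - gamma) * reward M s a s' + gamma * v s')
        | p in Usa s a])).

Fixpoint value_iteration (R : realType) (S A : finType) (M : rmdp R S A)
    (Usa : S -> A -> set (S -> R)) (gamma : nat -> R) (t : nat) : S -> R :=
  if t is u.+1 then
    robust_bellman M Usa (gamma u) (value_iteration M Usa gamma u)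
  else fun=> 0.

(* Main.v *)
(* Every limit as the discount factor tends to 1 is taken along an ultrafilter
   on the factors 1 - 1/(n + 1), so that selections from finite sets are
   eventually constant and bounded or compact-valued families converge.

   A kernel P together with y such that P_a y <= y and, for every e > 0, some h
   with r_a + P_a h <= y + e + h for all actions a, bounds from above both the
   gains against P and the limit of value iteration. Let g be the infimum of
   such y. Finite subgames have stationary saddle points, and the policies being
   finitely many, a single policy pi satisfies g <= P_pi g and has gain at least
   g against all P. Hence g is the optimal gain. The discounted values of the
   game where pi is fixed then have a limit at least g, which yields the dual
   certificate g - e + h <= r_pi + P_pi h, hence the lower bound on value
   iteration.

   Under a certificate, y + 2e + (1 - gamma_t) h is a supersolution of the t-th
   step once 1 - gamma_t is small, since 1 - gamma_t is nonincreasing; the error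
   of value iteration is multiplied by gamma_t = omega_t / omega_(t+1) at each
   step, hence is O(1 / omega_t). *)

Require Import Defs.
From mathcomp Require Import all_boot all_order all_algebra.
From mathcomp Require Import all_classical all_reals all_analysis.
From mathcomp Require Import ring lra.

Set Implicit Arguments.
Unset Strict Implicit.
Unset Printing Implicit Defensive.

Import Order.TTheory GRing.Theory Num.Theory numFieldNormedType.Exports.

Local Open Scope classical_set_scope.
Local Open Scope ring_scope.

(** * Expectations under probability vectors, and the Poisson equation of a stochastic matrix *)

Definition mean (R : realType) (S : finType) (p f : S -> R) : R :=
  \sum_s p s * f s.

Section Mean.
Variables (R : realType) (S : finType).
Implicit Types (p f g : S -> R).

Lemma ler_mean p f g : simplex p -> (forall s, f s <= g s) ->
  mean p f <= mean p g.
Proof. by move=> [p0 _] fg; apply: ler_sum => s _; exact: ler_wpM2l. Qed.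

Lemma mean_cst p (c : R) : simplex p -> mean p (fun=> c) = c.
Proof. by move=> [_ p1]; rewrite /mean -mulr_suml p1 mul1r. Qed.

Lemma mean_lin p (a b : R) f g :
  mean p (fun s => a * f s + b * g s) = a * mean p f + b * mean p g.
Proof.
rewrite /mean !mulr_sumr -big_split /=; apply: eq_bigr => s _; ring.
Qed.

Lemma mean_affine p (a c : R) f : simplex p ->
  mean p (fun s => a * f s + c) = a * mean p f + c.
Proof.
move=> hp; rewrite -[in RHS](@mean_cst p c) // -[mean p (fun=> c)]mul1r.
by rewrite -mean_lin; apply: eq_bigr => s _; rewrite mul1r.
Qed.

Lemma eq_mean p f g : f =1 g -> mean p f = mean p g.
Proof. by move=> fg; apply: eq_bigr => s _; rewrite fg. Qed.

Lemma mean_le_cst p f (c : R) : simplex p -> (forall s, f s <= c) ->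
  mean p f <= c.
Proof. by move=> hp fc; rewrite -(@mean_cst p c) //; exact: ler_mean. Qed.

Lemma mean_ge_cst p f (c : R) : simplex p -> (forall s, c <= f s) ->
  c <= mean p f.
Proof. by move=> hp fc; rewrite -(@mean_cst p c) //; exact: ler_mean. Qed.

Lemma normr_mean_le p f (c : R) : simplex p -> (forall s, `|f s| <= c) ->
  `|mean p f| <= c.
Proof.
move=> hp fc; rewrite ler_norml mean_le_cst ?mean_ge_cst //= => s.
  by have := fc s; rewrite ler_norml => /andP[].
by have := fc s; rewrite ler_norml => /andP[].
Qed.

Lemma finite_normr_bound f : exists2 c : R, 0 <= c & forall s, `|f s| <= c.
Proof.
exists (\sum_s `|f s|); first exact: sumr_ge0.
by move=> s; rewrite (bigD1 s) //= lerDl sumr_ge0.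
Qed.

Lemma exists_max f (s0 : S) : exists s, forall s', f s' <= f s.
Proof.
by case: (@arg_maxP _ R S s0 xpredT f) => // s _ hs; exists s => s'; exact: hs.
Qed.

End Mean.


(* A power bounded operator P satisfies ker (1 - P)^2 = ker (1 - P), hence
   im (1 - P)^2 = im (1 - P): so (1 - P) c = (1 - P)^2 h for some h, and
   g = c - (1 - P) h is invariant. *)
Lemma poisson (R : realType) (S : finType) (Q : S -> S -> R) (c : S -> R) :
  (forall s, simplex (Q s)) ->
  exists g h, (forall s, mean (Q s) g = g s) /\
              (forall s, c s + mean (Q s) h = g s + h s).
Proof.
move=> hQ.
pose fun_of (u : 'rV[R]_#|S|) (s : S) : R := u 0 (enum_rank s).
(* The transpose of [Q]: functions are row vectors here, so multiplying by [P] on the right takes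
   conditional expectations. *)
pose P : 'M[R]_#|S| := \matrix_(i, j) Q (enum_val j) (enum_val i).
have meanE (u : 'rV_#|S|) s : mean (Q s) (fun_of u) = fun_of (u *m P) s.
  rewrite /fun_of mxE /mean (reindex_onto enum_val enum_rank) => [|? _]; last first.
    exact: enum_rankK.
  rewrite (eq_bigl xpredT) => [|i]; last by rewrite enum_valK eqxx.
  by apply: eq_bigr => i _; rewrite mxE enum_valK enum_rankK mulrC.
pose B := 1%:M - P.
have injB (y : 'rV_#|S|) : y *m B *m B = 0 -> y *m B = 0.
  set x := y *m B => xB.
  have xP : x *m P = x.
    by move: xB; rewrite /B mulmxBr mulmx1 => /eqP; rewrite subr_eq0 => /eqP <-.
  have yP : y *m P = y - x by rewrite /x /B mulmxBr mulmx1 opprB addrC subrK.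
  clearbody x.
  have [C C0 hC] := finite_normr_bound (fun_of y).
  (* Applying [P] n times to [y] gives [y - x *+ n], which stays within the bound [C] of [y]; hence
     [n * |x_i| <= 2 * C] for every n, forcing [x = 0]. *)
  have bound n s : `|fun_of (y - x *+ n) s| <= C.
    elim: n s => [|n IH] s; first by rewrite mulr0n subr0.
    have -> : y - x *+ n.+1 = (y - x *+ n) *m P.
      have xnP : x *+ n *m P = x *+ n by rewrite -[LHS]/(mulmxr P _) raddfMn /= xP.
      by rewrite mulmxBl yP xnP mulrS opprD addrA.
    by rewrite -meanE; apply: normr_mean_le.
  apply/rowP => i; rewrite [RHS]mxE; apply/eqP/negPn/negP => xi0.
  have := archi_boundP (divr_ge0 (mulr_ge0 (ler0n R 2) C0) (normr_ge0 (x 0 i))).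
  set n := Num.bound _; rewrite ltr_pdivrMr ?normr_gt0 //; apply/negP.
  rewrite -leNgt.
  have := bound n (enum_val i); have := hC (enum_val i).
  rewrite /fun_of !enum_valK !mxE mulmxnE => h1 h2.
  have -> : n%:R * `|x 0 i| = `|y 0 i - (y 0 i - x 0 i *+ n)|.
    by rewrite opprB addrC subrK normrMn mulr_natl.
  by apply: le_trans (ler_normB _ _) _; lra.
have rk : \rank (B *m B) = \rank B.
  rewrite -[RHS](mxrank_mul_ker B B).
  suff -> : (B :&: kermx B)%MS = 0 by rewrite mxrank0 addn0.
  apply/eqP; rewrite -submx0; apply/rV_subP => u; rewrite sub_capmx.
  move=> /andP[/submxP[y ->] /sub_kermxP /injB ->]; exact: sub0mx.
have subB : (B <= B *m B)%MS.
  by have /mxrank_leqif_eq[_] := submxMl B B; rewrite rk eqxx => /esym/andP[].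
have /submxP[d hd] : (\row_i c (enum_val i) *m B <= B *m B)%MS.
  exact: submx_trans (submxMl _ _) subB.
pose u := \row_i c (enum_val i) - d *m B.
exists (fun_of u), (fun_of d); split=> s.
  have : u *m B = 0 by rewrite /u mulmxBl hd mulmxA subrr.
  by rewrite meanE /B mulmxBr mulmx1 => /eqP; rewrite subr_eq0 => /eqP <-.
rewrite meanE /fun_of /u /B mulmxBr mulmx1 !mxE enum_rankK; ring.
Qed.

(** * Long-run averages computed from sums over finite histories *)

Section PathSums.
Variables (R : realType) (S A : finType) (M : rmdp R S A).
Implicit Types (pi : {ffun S -> A}) (P : transition R S A).

Let consf (n : nat) (x : S * A) (h : {ffun 'I_n -> S * A}) :
    {ffun 'I_n.+1 -> S * A} :=
  [ffun i => if unlift ord0 i is Some j then h j else x].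

Let consf0 n x h : @consf n x h ord0 = x.
Proof. by rewrite ffunE unlift_none. Qed.

Let consfS n x h (j : 'I_n) : consf x h (lift ord0 j) = h j.
Proof. by rewrite ffunE liftK. Qed.

Let sum_consf n (F : {ffun 'I_n.+1 -> S * A} -> R) :
  \sum_h F h = \sum_x \sum_h F (consf x h).
Proof.
rewrite pair_big /= (reindex (fun p => consf p.1 p.2)) //=.
exists (fun h : {ffun 'I_n.+1 -> S * A} => (h ord0, [ffun j => h (lift ord0 j)])).
  move=> [x h] _ /=; congr pair; first exact: consf0.
  by apply/ffunP => j; rewrite ffunE consfS.
move=> h _ /=; apply/ffunP => i; case: (unliftP ord0 i) => [j|] ->.
  by rewrite consfS ffunE.
by rewrite consf0.
Qed.

Let path_prob_consf pi P s n x (h : {ffun 'I_n.+1 -> S * A}) :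
  path_prob pi P s (consf x h) =
  (x == (s, pi s))%:R * (P s (pi s) (h ord0).1 * path_prob pi P (h ord0).1 h).
Proof.
have wS (t : 'I_n) : widen_ord (leqnSn n.+1) (lift ord0 t) =
    lift ord0 (widen_ord (leqnSn n) t) by exact/val_inj.
have w0 : widen_ord (leqnSn n.+1) ord0 = ord0 by exact/val_inj.
rewrite /path_prob consf0 big_ord_recl consf0.
rewrite [X in _ * X = _]big_ord_recl w0 consf0 consfS.
under eq_bigr do rewrite consfS.
under [X in _ * _ * (_ * X) = _]eq_bigr do rewrite wS !consfS.
case: x => s1 a1 /=; rewrite xpair_eqE eqxx mul1r.
case: eqP => [->|_]; last by rewrite !mul0r.
by case: eqP => [->|_]; rewrite ?mul0r ?mulr0 ?mul0r //= !mul1r mulrCA.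
Qed.

Let sum_indicator (x0 : S * A) (F : S * A -> R) :
  \sum_x (x == x0)%:R * F x = F x0.
Proof.
rewrite (bigD1 x0) //= eqxx mul1r big1 ?addr0 // => x /negPf ->.
by rewrite mul0r.
Qed.

(** Markov property: after a first transition to [s'], the rest of the history is a path started at
    [s']. *)
Let sum_path_prob_consf pi P s n (F : S -> {ffun 'I_n.+1 -> S * A} -> R) :
  \sum_(h : {ffun 'I_n.+2 -> S * A})
    path_prob pi P s h * F (h (lift ord0 ord0)).1 [ffun j => h (lift ord0 j)] =
  mean (P s (pi s)) (fun s' =>
    \sum_(h : {ffun 'I_n.+1 -> S * A}) path_prob pi P s' h * F s' h).
Proof.
rewrite sum_consf exchange_big /=.
under eq_bigr => h _.
  under eq_bigr => x _.
    rewrite path_prob_consf consfS.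
    have -> : [ffun j => consf x h (lift ord0 j)] = h.
      by apply/ffunP => j; rewrite ffunE consfS.
    rewrite -mulrA; over.
  rewrite sum_indicator; over.
rewrite /mean; under [RHS]eq_bigr do rewrite mulr_sumr.
rewrite exchange_big; apply: eq_bigr => h _ /=.
rewrite (bigD1 (h ord0).1) //= big1 ?addr0 ?mulrA // => s' /negPf neq.
by rewrite /path_prob eq_sym neq !mul0r mulr0.
Qed.

Let sum_path_prob pi P s n : (forall s a, simplex (P s a)) ->
  \sum_(h : {ffun 'I_n.+1 -> S * A}) path_prob pi P s h = 1.
Proof.
move=> hP; elim: n s => [|n IH] s.
  rewrite sum_consf; under eq_bigr => x _.
    rewrite (eq_bigr (fun=> (x == (s, pi s))%:R)) => [|h _]; last first.
      rewrite /path_prob big_ord0 big_ord1 !consf0 mulr1; case: x => s1 a1 /=.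
      rewrite xpair_eqE; case: eqP => [->|]; rewrite ?mul0r ?mul1r //.
    rewrite sumr_const card_ffun card_ord expn0 mulr1n -[_%:R]mulr1; over.
  by rewrite sum_indicator.
under eq_bigr do rewrite -[path_prob _ _ _ _]mulr1.
rewrite (sum_path_prob_consf pi P s (fun _ _ => 1)).
rewrite -[RHS](mean_cst 1 (hP s (pi s))); apply: eq_mean => s'.
by under eq_bigr do rewrite mulr1; exact: IH.
Qed.

Let total n (h : {ffun 'I_n.+1 -> S * A}) : R :=
  \sum_(t < n) reward M (h (widen_ord (leqnSn n) t)).1
                        (h (widen_ord (leqnSn n) t)).2 (h (lift ord0 t)).1.

Let expected_total pi P s n : R :=
  \sum_(h : {ffun 'I_n.+1 -> S * A}) path_prob pi P s h * total h.

Let expected_totalS pi P s n : (forall s a, simplex (P s a)) ->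
  expected_total pi P s n.+1 =
  mean (P s (pi s)) (fun s' =>
    reward M s (pi s) s' + expected_total pi P s' n).
Proof.
move=> hP; rewrite /expected_total.
pose F s' (h : {ffun 'I_n.+1 -> S * A}) := reward M s (pi s) s' + total h.
transitivity (mean (P s (pi s)) (fun s' =>
    \sum_(h : {ffun 'I_n.+1 -> S * A}) path_prob pi P s' h * F s' h)).
  rewrite -sum_path_prob_consf; apply: eq_bigr => h _.
  rewrite /path_prob; case: eqP => [h0|_]; last by rewrite !mul0r.
  rewrite big_ord_recl; case: eqP => [h0a|_]; last by rewrite !(mul0r, mulr0).
  congr (_ * _); rewrite /F /total big_ord_recl.
  have w0 : widen_ord (leqnSn n.+1) ord0 = ord0 by exact/val_inj.
  rewrite w0 h0a h0; congr (_ + _); apply: eq_bigr => t _.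
  have wS : widen_ord (leqnSn n.+1) (lift ord0 t) =
    lift ord0 (widen_ord (leqnSn n) t) by exact/val_inj.
  by rewrite !ffunE wS.
apply: eq_mean => s'; rewrite /F.
under eq_bigr do rewrite mulrDr.
by rewrite big_split /= -mulr_suml sum_path_prob // mul1r.
Qed.

Let expected_average_rewardE pi P s T :
  expected_average_reward M pi P s T =
  T.+1%:R^-1 * expected_total pi P s T.+1.
Proof.
rewrite /expected_total mulr_sumr; apply: eq_bigr => h _.
by rewrite mulrCA.
Qed.

(** By induction on n, the expected total reward over n steps stays within [C] of [n * g + h], where
    [C] bounds [|h|]. Its average over T + 1 steps is thus within [2 * C / (T + 1)] of [g]. *)
Lemma long_run_average_poisson pi P (g h : S -> R) :
  (forall s a, simplex (P s a)) ->
  (forall s, mean (P s (pi s)) g = g s) ->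
  (forall s, mean (P s (pi s)) (reward M s (pi s)) + mean (P s (pi s)) h =
     g s + h s) ->
  forall s, long_run_average M pi P s = g s.
Proof.
move=> hP hg hh s; have [C C0 hC] := finite_normr_bound h.
have up n s' : expected_total pi P s' n <= n%:R * g s' + h s' + C /\
               n%:R * g s' + h s' - C <= expected_total pi P s' n.
  elim: n s' => [|n IH] s'.
    have -> : expected_total pi P s' 0 = 0.
      by apply: big1 => f _; rewrite /total big_ord0 mulr0.
    by have := hC s'; rewrite ler_norml => /andP[*]; split; lra.
  rewrite expected_totalS //.
  have meanE (c : R) : mean (P s' (pi s')) (fun s0 => reward M s' (pi s') s0 +
      (n%:R * g s0 + h s0 + c)) = n.+1%:R * g s' + h s' + c.
    transitivity (mean (P s' (pi s')) (fun s0 => 1 *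
      (1 * reward M s' (pi s') s0 + 1 * (n%:R * g s0 + 1 * h s0)) + c)).
      by apply: eq_mean => s0; ring.
    by rewrite mean_affine // !mean_lin hg -[n.+1]addn1 natrD;
       have := hh s'; lra.
  split; rewrite -meanE; apply: ler_mean => // s0; have [] := IH s0; lra.
apply/cvg_lim => //; apply/cvgrPdist_le => /= e e0.
near=> T; rewrite expected_average_rewardE.
have T0 : (0 : R) < T.+1%:R by [].
have hT : 2 * C <= e * T.+1%:R.
  rewrite [leRHS]mulrC -ler_pdivrMr // -[T.+1]addn1 natrD ler_wpDr //.
  by near: T; exact: nbhs_infty_ger.
have -> : g s - T.+1%:R^-1 * expected_total pi P s T.+1 =
  T.+1%:R^-1 * (T.+1%:R * g s - expected_total pi P s T.+1) by field.
rewrite normrM ger0_norm ?invr_ge0 // ler_pdivrMl // [leRHS]mulrC.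
apply: le_trans hT; have [] := up T.+1 s.
have := hC s; rewrite !ler_norml => /andP[h1 h2] h3 h4.
apply/andP; split; lra.
Unshelve. all: by end_near. Qed.

End PathSums.

(** * Discounted evaluations compared with the gain of a fixed chain *)

(** Maximum principle: at a maximizer [m], [z m <= gamma * z m] with [gamma < 1]. *)
Lemma discounted_nonpos (R : realType) (S : finType) (Q : S -> S -> R)
    (gamma : R) (z : S -> R) :
  (forall s, simplex (Q s)) -> 0 <= gamma < 1 ->
  (forall s, z s <= gamma * mean (Q s) z) -> forall s, z s <= 0.
Proof.
move=> hQ /andP[g0 g1] hz s; have [m hm] := exists_max z s.
apply: le_trans (hm s) _.
have h1 : mean (Q m) z <= z m by exact: mean_le_cst.
have h2 : z m <= gamma * z m by apply: le_trans (hz m) _; exact: ler_wpM2l.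
have h3 : 0 < 1 - gamma by rewrite subr_gt0.
rewrite -(pmulr_rle0 _ h3); lra.
Qed.

(* With y := g + (1 - gamma) h + (1 - gamma) C one has
   y >= (1 - gamma) c + gamma Q y. *)
Lemma discounted_le_gain (R : realType) (S : finType) (Q : S -> S -> R)
    (c g h : S -> R) (C gamma : R) (x : S -> R) :
  (forall s, simplex (Q s)) -> (forall s, mean (Q s) g = g s) ->
  (forall s, c s + mean (Q s) h = g s + h s) -> (forall s, `|h s| <= C) ->
  0 <= gamma < 1 -> (forall s, x s <= (1 - gamma) * c s + gamma * mean (Q s) x) ->
  forall s, x s <= g s + (1 - gamma) * (C + C).
Proof.
move=> hQ hg hh hC hgam hx s; have /andP[g0 g1] := hgam.
have l0 : 0 <= 1 - gamma by rewrite subr_ge0 ltW.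
pose z s' := 1 * (1 * x s' + -1 * (1 * g s' + (1 - gamma) * h s')) +
  - ((1 - gamma) * C).
have /(_ s) : forall s', z s' <= 0.
  apply: (discounted_nonpos hQ hgam) => s'.
  rewrite /z (mean_affine _ _ _ (hQ s')) !mean_lin hg.
  have h1 : - C <= mean (Q s') h.
    by apply: mean_ge_cst => // s0; have := hC s0; rewrite ler_norml => /andP[].
  have := hx s'; have := ler_wpM2l l0 h1; have := hh s'.
  move: (mean (Q s') h) => m ee.
  have -> : c s' = g s' + h s' - m by rewrite -ee addrK.
  move=> h2 h3; have := ler_wpM2l l0 h2; nra.
have := hC s; rewrite ler_norml => /andP[_ h1]; have := ler_wpM2l l0 h1.
rewrite /z; lra.
Qed.

(** * The discounted Bellman operator *)

Section QValue.
Variables (R : realType) (S A : finType).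
Implicit Types (r : S -> A -> S -> R) (K : S -> A -> set (S -> R)).

Definition q_value r (gamma : R) (v : S -> R) s a (p : S -> R) : R :=
  mean p (fun s' => (1 - gamma) * r s a s' + gamma * v s').

Lemma q_valueE r gamma v s a p :
  q_value r gamma v s a p = (1 - gamma) * mean p (r s a) + gamma * mean p v.
Proof. exact: mean_lin. Qed.

Lemma ler_q_value r gamma v w s a p : 0 <= gamma -> simplex p ->
  (forall s', v s' <= w s') -> q_value r gamma v s a p <= q_value r gamma w s a p.
Proof.
by move=> g0 hp vw; rewrite !q_valueE lerD2l ler_wpM2l // ler_mean.
Qed.

Lemma reward_bound r : exists2 C : R, 0 <= C & forall s a s', `|r s a s'| <= C.
Proof.
have [C C0 hC] := finite_normr_bound (fun x : S * A * S => r x.1.1 x.1.2 x.2).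
by exists C => // s a s'; exact: (hC (s, a, s')).
Qed.

(** Convertible to [robust_bellman] when [r] is [reward M]. Rewards, actions and kernel sets are
    parameters so that finite subgames and the game with a fixed policy are also instances. *)
Definition bellman r K (gamma : R) (v : S -> R) (s : S) : R :=
  sup (range (fun a => inf [set q_value r gamma v s a p | p in K s a])).

Variables (r : S -> A -> S -> R) (K : S -> A -> set (S -> R)).
Hypotheses (A0 : (0 < #|A|)%N) (K0 : forall s a, K s a !=set0).
Hypothesis K_simplex : forall s a, K s a `<=` @simplex R S.
Implicit Types (gamma : R) (v : S -> R).

Let has_inf_q gamma v s a : has_inf [set q_value r gamma v s a p | p in K s a].
Proof.
split; first by have [p hp] := K0 s a; exists (q_value r gamma v s a p), p.
have [C _ hC] :=
  finite_normr_bound (fun s' => (1 - gamma) * r s a s' + gamma * v s').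
exists (- C) => _ [p hp <-]; apply: mean_ge_cst; first exact: K_simplex hp.
by move=> s'; have := hC s'; rewrite ler_norml => /andP[].
Qed.

Let has_sup_inf gamma v s :
  has_sup (range (fun a => inf [set q_value r gamma v s a p | p in K s a])).
Proof.
have [a _] : exists a : A, a \in A by apply/existsP; rewrite -lt0n.
split; first by eexists; exists a.
have [C _ hC] :=
  finite_normr_bound (fun a => inf [set q_value r gamma v s a p | p in K s a]).
by exists C => _ [b _ <-]; exact: le_trans (ler_norm _) (hC b).
Qed.

Lemma bellman_ge gamma v s a (c : R) :
  (forall p, K s a p -> c <= q_value r gamma v s a p) ->
  c <= bellman r K gamma v s.
Proof.
move=> hc; apply: (@le_trans _ _ (inf [set q_value r gamma v s a p | p in K s a])).
  by apply: lb_le_inf => [|_ [p hp <-]]; [exact: (has_inf_q _ _ _ _).1|exact: hc].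
by apply: ub_le_sup; [exact: (has_sup_inf _ _ _).2|exists a].
Qed.

Lemma bellman_le gamma v s (c : R) :
  (forall a, exists2 p, K s a p & q_value r gamma v s a p <= c) ->
  bellman r K gamma v s <= c.
Proof.
move=> hc; apply: ge_sup; first exact: (has_sup_inf _ _ _).1.
move=> _ [a _ <-]; have [p hp pc] := hc a; apply: le_trans pc.
by apply: ge_inf; [exact: (has_inf_q _ _ _ _).2|exists p].
Qed.

Lemma bellman_le_q gamma v s : exists a, forall p, K s a p ->
  bellman r K gamma v s <= q_value r gamma v s a p.
Proof.
have [a0 _] : exists a : A, a \in A by apply/existsP; rewrite -lt0n.
have [a ha] :=
  exists_max (fun a => inf [set q_value r gamma v s a p | p in K s a]) a0.
exists a => p hp; apply: (@le_trans _ _ (inf [set q_value r gamma v s a p | p in K s a])).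
  by apply: ge_sup; [exact: (has_sup_inf _ _ _).1|move=> _ [b _ <-]; exact: ha].
by apply: ge_inf; [exact: (has_inf_q _ _ _ _).2|exists p].
Qed.

Lemma bellman_q_lt gamma v s a (e : R) : 0 < e ->
  exists2 p, K s a p & q_value r gamma v s a p < bellman r K gamma v s + e.
Proof.
move=> e0; have [_ [p hp <-] lt_p] := inf_adherent e0 (has_inf_q gamma v s a).
exists p => //; apply: lt_le_trans lt_p _; rewrite lerD2r.
by apply: ub_le_sup; [exact: (has_sup_inf _ _ _).2|exists a].
Qed.

Lemma ler_bellman gamma v w s : 0 <= gamma -> (forall s', v s' <= w s') ->
  bellman r K gamma v s <= bellman r K gamma w s.
Proof.
move=> g0 vw; have [a ha] := bellman_le_q gamma v s; apply: (@bellman_ge _ _ _ a).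
by move=> p hp; apply: le_trans (ha p hp) _; apply: ler_q_value => //; exact: K_simplex hp.
Qed.

(* Tarski: the fixed point is the supremum of the subsolutions bounded by C. *)
Lemma bellman_fixpoint gamma (C : R) : 0 <= gamma <= 1 -> 0 <= C ->
  (forall s a s', `|r s a s'| <= C) ->
  exists x, (forall s, bellman r K gamma x s = x s) /\ (forall s, `|x s| <= C).
Proof.
move=> /andP[g0 g1] C0 hC; have l0 : 0 <= 1 - gamma by rewrite subr_ge0.
pose X := [set x : S -> R | forall s, x s <= C /\ x s <= bellman r K gamma x s].
have rC s a s' : - C <= r s a s' <= C by rewrite -ler_norml.
have XC : X (fun=> - C).
  have [a0 _] : exists a : A, a \in A by apply/existsP; rewrite -lt0n.
  move=> s; split; first lra.
  apply: (@bellman_ge _ _ _ a0) => p hp.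
  apply: mean_ge_cst; [exact: K_simplex hp|move=> s'].
  by have /andP[h _] := rC s a0 s'; have := ler_wpM2l l0 h; lra.
pose x s := sup [set y s | y in X].
have hasX s : has_sup [set y s | y in X].
  split; first by exists (- C), (fun=> - C).
  by exists C => _ [y Xy <-]; exact: (Xy s).1.
have Xx y s : X y -> y s <= x s.
  by move=> Xy; apply: ub_le_sup; [exact: (hasX s).2|exists y].
have xC s : x s <= C.
  by apply: ge_sup; [exact: (hasX s).1|move=> _ [y Xy <-]; exact: (Xy s).1].
have xB s : x s <= bellman r K gamma x s.
  apply: ge_sup; [exact: (hasX s).1|move=> _ [y Xy <-]].
  by apply: le_trans (Xy s).2 _; apply: ler_bellman => // s'; exact: Xx.
exists x; split=> s; last by rewrite ler_norml xC (Xx (fun=> - C)).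
(* The image of [x] is again a subsolution bounded by [C], hence lies below the supremum [x]. *)
apply/eqP; rewrite eq_le xB andbT; apply: (Xx (bellman r K gamma x)) => s'.
split; last by apply: ler_bellman => // s''; exact: xB.
apply: bellman_le => a; have [p hp] := K0 s' a; exists p => //.
apply: mean_le_cst; [exact: K_simplex hp|move=> s''].
have /andP[_ h] := rC s' a s''.
by have := ler_wpM2l l0 h; have := ler_wpM2l g0 (xC s''); lra.
Qed.

End QValue.

(** * Limits along an ultrafilter *)

Section Ultra.
Variables (U : set_system nat).
Hypothesis hU : UltraFilter U.

(** Otherwise the complements of the finitely many fibres of [f] all belong to [U], and so does
    their empty intersection. *)
Lemma ultra_finite (I : finType) (f : nat -> I) :
  exists i, \forall n \near U, f n = i.
Proof.
apply: contrapT => /forallNP none.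
have : \forall n \near U, forall i, f n <> i.
  apply: filter_forall => i.
  by have [/none|//] := in_ultra_setVsetC [set n | f n = i] hU.
by move=> /filter_ex[n /(_ (f n))].
Qed.

(** The image of an ultrafilter is an ultrafilter, and one containing a compact set converges in
    it. *)
Lemma ultra_cvg_compact (T : topologicalType) (K : set T) (f : nat -> T) :
  compact K -> (forall n, K (f n)) -> exists2 l, K l & f n @[n --> U] --> l.
Proof.
move=> cK fK; have cU : UltraFilter (f n @[n --> U]).
  split=> [|G GG sUG]; first exact: fmap_proper_filter.
  apply/seteqP; split=> // B GB.
  have [//|UnB] := in_ultra_setVsetC (f @^-1` B) hU.
  have GnB : G (~` B) by exact: sUG.
  have : G (B `&` ~` B) by exact: filterI.
  by rewrite setICr => /filter_not_empty.
have : (f n @[n --> U]) K by exact: (@filterE _ U _ (f @^-1` K)).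
by move: cK; rewrite compact_ultra => /[apply] -[l []]; exists l.
Qed.

Lemma ultra_cvg_bounded (R : realType) (x : nat -> R) (C : R) :
  (forall n, `|x n| <= C) -> exists l : R, x n @[n --> U] --> l.
Proof.
move=> hC; have [|l _ hl] := @ultra_cvg_compact R _ x (@segment_compact R (- C) C).
  by move=> n /=; rewrite in_itv /= -ler_norml.
by exists l.
Qed.

End Ultra.

Lemma cvg_mean (R : realType) (S : finType) (U : set_system nat)
    (p f : nat -> S -> R) (q g : S -> R) : UltraFilter U ->
  (forall s, p n s @[n --> U] --> q s) -> (forall s, f n s @[n --> U] --> g s) ->
  mean (p n) (f n) @[n --> U] --> mean q g.
Proof.
move=> hU hp hf; rewrite /mean.
by apply: cvg_big => [|s _]; [exact: add_continuous|exact: cvgM].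
Qed.

(** * Passage between discounted and average-reward inequalities *)

Section Certificates.
Variables (R : realType) (S A : finType) (r : S -> A -> S -> R).

(** Vanishing discount: with the potential [gamma / (1 - gamma) * x], a discounted sub- or
    supersolution [x] satisfies the corresponding average-reward inequality with [x] as gain. *)
Lemma q_value_gap (gamma : R) (x : S -> R) s a p : gamma < 1 ->
  mean p (r s a) + mean p (fun s' => gamma / (1 - gamma) * x s') -
    (x s + gamma / (1 - gamma) * x s) =
  (q_value r gamma x s a p - x s) / (1 - gamma).
Proof.
move=> g1; have l0 : 1 - gamma != 0 by rewrite subr_eq0 gt_eqF.
have -> : mean p (fun s' => gamma / (1 - gamma) * x s') =
    gamma / (1 - gamma) * mean p x.
  by rewrite /mean mulr_sumr; apply: eq_bigr => s' _; rewrite mulrCA.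
by rewrite q_valueE; field.
Qed.

Lemma q_value_shift (gamma c : R) (x : S -> R) s a p : simplex p ->
  q_value r gamma (fun s' => x s' + c) s a p = q_value r gamma x s a p + gamma * c.
Proof.
move=> hp; rewrite !q_valueE.
have -> : mean p (fun s' => x s' + c) = mean p x + c.
  rewrite -[mean p x]mul1r -mean_affine //.
  by apply: eq_mean => s'; rewrite mul1r.
by ring.
Qed.

Let mean_shift2 p (y h : S -> R) (c l : R) : simplex p ->
  mean p (fun s' => y s' + c + l * h s') = mean p y + c + l * mean p h.
Proof.
move=> hp.
transitivity (mean p (fun s' => 1 * (1 * y s' + l * h s') + c)).
  by apply: eq_mean => s'; ring.
by rewrite mean_affine // mean_lin; ring.
Qed.

(** One [e] pays for the slack of the average-reward inequality, the other for the second-order term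
    [(1 - gamma)^2 * mean p h]. *)
Lemma q_value_potential_le (gamma e : R) (y h : S -> R) s a p :
  simplex p -> 0 <= gamma <= 1 -> mean p y <= y s ->
  mean p (r s a) + mean p h <= y s + e + h s ->
  (forall s', `|(1 - gamma) * h s'| <= e) ->
  q_value r gamma (fun s' => y s' + (e + e) + (1 - gamma) * h s') s a p <=
    y s + (e + e) + (1 - gamma) * h s.
Proof.
move=> hp /andP[g0 g1] hy hh hC; have l0 : 0 <= 1 - gamma by rewrite subr_ge0.
rewrite q_valueE mean_shift2 //.
have : - e <= mean p (fun s' => (1 - gamma) * h s' + 0).
  by apply: mean_ge_cst => // s'; have := hC s'; rewrite addr0 ler_norml => /andP[].
rewrite mean_affine // addr0 => /(ler_wpM2l l0).
by have := ler_wpM2l l0 hh; have := ler_wpM2l g0 hy; lra.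
Qed.

Lemma q_value_potential_ge (gamma e : R) (y h : S -> R) s a p :
  simplex p -> 0 <= gamma <= 1 -> y s <= mean p y ->
  y s - e + h s <= mean p (r s a) + mean p h ->
  (forall s', `|(1 - gamma) * h s'| <= e) ->
  y s - (e + e) + (1 - gamma) * h s <=
  q_value r gamma (fun s' => y s' - (e + e) + (1 - gamma) * h s') s a p.
Proof.
move=> hp /andP[g0 g1] hy hh hC; have l0 : 0 <= 1 - gamma by rewrite subr_ge0.
rewrite q_valueE mean_shift2 //.
have : mean p (fun s' => (1 - gamma) * h s' + 0) <= e.
  by apply: mean_le_cst => // s'; have := hC s'; rewrite addr0 ler_norml => /andP[].
rewrite mean_affine // addr0 => /(ler_wpM2l l0).
by have := ler_wpM2l l0 hh; have := ler_wpM2l g0 hy; lra.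
Qed.
End Certificates.

(** * Gains, guarantees and saddle points of finite subgames *)

Section Gain.
Variables (R : realType) (S A : finType) (M : rmdp R S A).
Implicit Types (pi : {ffun S -> A}) (P : transition R S A).

Let r := reward M.
Let avg := long_run_average M.

Let U_simplex P : uncertainty M P -> forall s a, simplex (P s a).
Proof. exact: uncertainty_stochastic. Qed.

(** The Poisson equation of the chain gives a constant [C] uniform in [gamma]. Sub- and
    supersolutions are treated, so that no exact discounted value is required of [x]. *)
Lemma discounted_near_average pi P : uncertainty M P ->
  exists2 C : R, 0 <= C & forall gamma (x : S -> R), 0 <= gamma < 1 ->
    ((forall s, x s <= q_value r gamma x s (pi s) (P s (pi s))) ->
       forall s, x s <= avg pi P s + (1 - gamma) * C) /\
    ((forall s, q_value r gamma x s (pi s) (P s (pi s)) <= x s) ->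
       forall s, avg pi P s <= x s + (1 - gamma) * C).
Proof.
move=> UP; have hP := U_simplex UP.
have hQ s : simplex (P s (pi s)) by exact: hP.
have [g [h [hg hh]]] := poisson (fun s => mean (P s (pi s)) (r s (pi s))) hQ.
have avgE := long_run_average_poisson hP hg hh.
have [C C0 hC] := finite_normr_bound h.
have meanN p (f : S -> R) : mean p (fun s => - f s) = - mean p f.
  by rewrite /mean -sumrN; apply: eq_bigr => s _; rewrite mulrN.
exists (C + C); first exact: addr_ge0.
move=> gamma x hgam; split=> hx s; rewrite /avg avgE.
  apply: (discounted_le_gain hQ hg hh hC hgam) => s'.
  by rewrite -(q_valueE r); exact: hx.
(* The lower bound is the upper bound for the negated rewards. *)
have := @discounted_le_gain R S (fun s => P s (pi s))
  (fun s => - mean (P s (pi s)) (r s (pi s))) (fun s => - g s) (fun s => - h s)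
  C gamma (fun s => - x s) hQ.
have H1 s' : mean (P s' (pi s')) (fun s => - g s) = - g s' by rewrite meanN hg.
have H2 s' : - mean (P s' (pi s')) (r s' (pi s')) +
    mean (P s' (pi s')) (fun s => - h s) = - g s' - h s'.
  by rewrite meanN -!opprD hh.
have H3 s' : `|- h s'| <= C by rewrite normrN.
have H4 s' : - x s' <= (1 - gamma) * - mean (P s' (pi s')) (r s' (pi s')) +
    gamma * mean (P s' (pi s')) (fun s => - x s).
  by rewrite meanN !mulrN -opprD lerN2 -(q_valueE r); exact: hx.
by move=> /(_ H1 H2 H3 hgam H4 s); lra.
Qed.

Let gam n : R := 1 - harmonic n.

Let gam_lt1 n : 0 <= gam n < 1.
Proof.
rewrite /gam subr_ge0 ltrBlDr ltrDl harmonic_gt0 andbT /harmonic.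
by rewrite invf_le1 // ler1n.
Qed.

Let subr_gam n : 1 - gam n = harmonic n.
Proof. by rewrite /gam subKr. Qed.

(* The average-reward optimality inequalities for the max player facing P. *)
Definition guarantees P (y : S -> R) :=
  (forall s a, mean (P s a) y <= y s) /\
  forall e : R, 0 < e -> exists h : S -> R,
    forall s a, mean (P s a) (r s a) + mean (P s a) h <= y s + e + h s.

(** The constant [- C] is a subsolution for every discount factor. *)
Lemma average_ge_reward_bound pi P (C : R) : uncertainty M P ->
  (forall s a s', `|r s a s'| <= C) -> forall s, - C <= avg pi P s.
Proof.
move=> UP hC s; have [C' C'0 /(_ _ (fun=> - C))hav] := discounted_near_average pi UP.
have hn n : - C <= avg pi P s + harmonic n * C'.
  rewrite -subr_gam; apply: (hav _ (gam_lt1 n)).1 => s'.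
  have /andP[g0 /ltW g1] := gam_lt1 n.
  apply: mean_ge_cst; first exact: U_simplex.
  move=> s''; have := hC s' (pi s') s''; rewrite ler_norml => /andP[h1 _].
  by have := ler_wpM2l (_ : 0 <= 1 - gam n) h1; rewrite subr_ge0 g1 => /(_ isT); lra.
have : avg pi P s + harmonic n * C' @[n --> \oo] --> avg pi P s + 0 * C'.
  by apply: cvgD; [exact: cvg_cst|apply: cvgMl; exact: cvg_harmonic].
rewrite mul0r addr0 => /cvgr_to_ge; apply; exact: nearW.
Qed.

(** The potential turns [y] into a discounted supersolution for [P], whatever the action chosen, and
    supersolutions nearly dominate the gain. *)
Lemma average_le_guarantee pi P y : uncertainty M P -> guarantees P y ->
  forall s, avg pi P s <= y s.
Proof.
move=> UP [hy hh] s; apply/ler_addgt0Pr => e e0.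
(* Two quarters shift the supersolution, one bounds its potential term, one the distance between
   discounted and average rewards. *)
have e4 : 0 < e / 4 by rewrite divr_gt0.
have [h hh4] := hh _ e4.
have [C C0 hC] := finite_normr_bound h.
have [C' C'0 hav] := discounted_near_average pi UP.
have [n [hn1 hn2]] : exists n, harmonic n * C <= e / 4 /\ harmonic n * C' <= e / 4.
  have small (B : R) : \forall n \near \oo, harmonic n * B <= e / 4.
    have : harmonic n * B @[n --> \oo] --> 0 * B.
      by apply: cvgMl; exact: cvg_harmonic.
    by rewrite mul0r => /cvgr_le; apply.
  exact: filter_ex (filterI (small C) (small C')).
have hn s' : `|harmonic n * h s'| <= e / 4.
  rewrite normrM ger0_norm ?harmonic_ge0 //; apply: le_trans hn1.
  by apply: ler_wpM2l => //; exact: harmonic_ge0.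
have := (hav (gam n) (fun s' => y s' + (e / 4 + e / 4) + (1 - gam n) * h s')
  (gam_lt1 n)).2.
have H s' : q_value r (gam n) (fun s' => y s' + (e / 4 + e / 4) + (1 - gam n) * h s')
   s' (pi s') (P s' (pi s')) <= y s' + (e / 4 + e / 4) + (1 - gam n) * h s'.
  apply: q_value_potential_le => //; first exact: U_simplex.
    by have /andP[-> /ltW] := gam_lt1 n.
  by move=> s''; rewrite subr_gam.
move=> /(_ H s); rewrite subr_gam => h1.
by have := hn s; rewrite ler_norml => /andP[_ h2]; lra.
Qed.

Let ultra_ge_infty : exists U : set_system nat, UltraFilter U /\ \oo `<=` U.
Proof. exact: ultraFilterLemma. Qed.

Let cvg_harmonicM (U : set_system nat) : UltraFilter U -> \oo `<=` U ->
  forall c : R, harmonic n * c @[n --> U] --> (0 : R).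
Proof.
move=> hU sU c; have : harmonic n * c @[n --> \oo] --> (0 : R).
  by rewrite -[X in _ --> X](mul0r c); apply: cvgMl; exact: cvg_harmonic.
by move=> h B hB; apply: sU; exact: h.
Qed.

Let cvg_q_value (U : set_system nat) (x : nat -> S -> R) (y : S -> R) s a p :
  UltraFilter U -> \oo `<=` U -> (forall s', x n s' @[n --> U] --> y s') ->
  q_value r (gam n) (x n) s a p @[n --> U] --> mean p y.
Proof.
move=> hU sU hx.
have h0 : harmonic n @[n --> U] --> (0 : R).
  by move=> B hB; apply: sU; exact: cvg_harmonic.
have -> : (fun n => q_value r (gam n) (x n) s a p) =
    (fun n => harmonic n * mean p (r s a) + (1 - harmonic n) * mean p (x n)).
  by apply/funext => n; rewrite q_valueE subr_gam.
have -> : mean p y = 0 + (1 - 0) * mean p y by rewrite subr0 mul1r add0r.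
apply: cvgD; first exact: cvg_harmonicM.
apply: cvgM; first by apply: cvgB => //; exact: cvg_cst.
by apply: cvg_mean => // s'; exact: cvg_cst.
Qed.

(* In the game restricted to finitely many transition kernels, some pair
   (pi, sigma) of stationary selections is optimal for every discount factor
   in a set of the ultrafilter. *)
Lemma finite_family_saddle (I : finType) (i0 : I) (F : I -> transition R S A) :
  (forall i, uncertainty M (F i)) ->
  exists (sigma : {ffun S * A -> I}) (pi : {ffun S -> A}) (y : S -> R),
  [/\ guarantees (fun s a => F (sigma (s, a)) s a) y,
      forall i s, y s <= avg pi (F i) s &
      forall i s, y s <= mean (F i s (pi s)) y].
Proof.
move=> UF; have hF i := U_simplex (UF i).
pose K s a := range (fun i => F i s a).
have K0 s a : K s a !=set0 by exists (F i0 s a), i0.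
have KS s a : K s a `<=` @simplex R S by move=> _ [i _ <-]; exact: hF.
have A0 := actions_nonempty M; have [C C0 hC] := reward_bound r.
have disc n : exists t : (S -> R) * {ffun S -> A} * {ffun S * A -> I},
    [/\ forall s, `|t.1.1 s| <= C,
      forall s i, t.1.1 s <= q_value r (gam n) t.1.1 s (t.1.2 s) (F i s (t.1.2 s)) &
      forall s a, q_value r (gam n) t.1.1 s a (F (t.2 (s, a)) s a) <= t.1.1 s].
  have /andP[g0 /ltW g1] := gam_lt1 n.
  have g01 : 0 <= gam n <= 1 by rewrite g0 g1.
  have [x [hx xC]] := bellman_fixpoint A0 K0 KS g01 C0 hC.
  have /choice[f hf] s := bellman_le_q r A0 K0 KS (gam n) x s.
  have /choice[m hm] sa := exists_max
    (fun i => - q_value r (gam n) x sa.1 sa.2 (F i sa.1 sa.2)) i0.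
  exists (x, [ffun s => f s], [ffun sa => m sa]); split=> //= [s i|s a].
    by rewrite ffunE -[leLHS]hx; apply: hf; exists i.
  (* The index [m (s, a)] does at least as well for nature as any [e]-optimal index, for every
     [e]. *)
  apply/ler_addgt0Pr => e e0.
  have [_ [i _ <-] lt_i] := bellman_q_lt r A0 K0 KS (gam n) x s a e0.
  rewrite ffunE; have := hm (s, a) i; rewrite lerN2 /= => /le_trans; apply.
  by rewrite -[in leRHS](hx s); exact: ltW.
have /choice[t ht] := disc.
have [U [hU sU]] := ultra_ge_infty.
have [pi hpi] := ultra_finite hU (fun n => (t n).1.2).
have [sigma hsigma] := ultra_finite hU (fun n => (t n).2).
have /choice[y hy] s : exists l : R, (t n).1.1 s @[n --> U] --> l.
  by apply: (@ultra_cvg_bounded _ hU _ _ C) => n; case: (ht n).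
exists sigma, pi, y; split.
- split=> [s a|e e0].
    apply: (ler_cvg_to (cvg_q_value s a hU sU hy) (hy s)).
    near=> n; have <- : (t n).2 = sigma by near: n.
    by case: (ht n).
  have near_y : \forall n \near U, forall s, (t n).1.1 s <= y s + e.
    by apply: filter_forall => s; apply: (cvgr_le _ (hy s)); rewrite ltrDl.
  (* A single n suffices for the potential: its values are within [e] of [y] and its selection is
     already [sigma]. *)
  have [n [hn hs]] := filter_ex (filterI near_y hsigma).
  exists (fun s => gam n / (1 - gam n) * (t n).1.1 s) => s a.
  have /andP[_ g1] := gam_lt1 n.
  have := q_value_gap r (t n).1.1 s a (F (sigma (s, a)) s a) g1.
  have : (q_value r (gam n) (t n).1.1 s a (F (sigma (s, a)) s a) - (t n).1.1 s) /
      (1 - gam n) <= 0.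
    rewrite pmulr_lle0 ?invr_gt0 ?subr_gt0 // subr_le0.
    by have [_ _ h] := ht n; move: h; rewrite hs; apply.
  by have := hn s; lra.
- move=> i s; have [C' C'0 hav] := discounted_near_average pi (UF i).
  have lim : avg pi (F i) s + harmonic n * C' @[n --> U] --> avg pi (F i) s.
    rewrite -[avg pi (F i) s in X in _ --> X]addr0.
    by apply: cvgD; [exact: cvg_cst|exact: cvg_harmonicM].
  apply: (ler_cvg_to (hy s) lim); near=> n.
  have hp : (t n).1.2 = pi by near: n.
  rewrite -subr_gam; apply: (hav _ _ (gam_lt1 n)).1 => s'.
  by have [_ h _] := ht n; rewrite -hp; exact: h.
- move=> i s; apply: (ler_cvg_to (hy s) (cvg_q_value s (pi s) hU sU hy)).
  near=> n; have <- : (t n).1.2 = pi by near: n.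
  by have [_ h _] := ht n; exact: h.
Unshelve. all: by end_near. Qed.

(** * The optimal gain as the least guaranteed bound *)

Variable Usa : S -> A -> set (S -> R).
Hypothesis hrect : sa_rectangular (uncertainty M) Usa.

Let UE P : uncertainty M P <-> forall s a, Usa s a (P s a).
Proof. by rewrite hrect.2. Qed.

Let Usa_simplex s a : Usa s a `<=` @simplex R S.
Proof. exact: hrect.1. Qed.

Let Usa_nonempty s a : Usa s a !=set0.
Proof. by have [P /UE hP] := uncertainty_nonempty M; exists (P s a). Qed.

Let upper_values s := [set y s | y in
  [set y | exists2 P, uncertainty M P & guarantees P y]].

Let g s := inf (upper_values s).

Let upper_lbound s : has_lbound (upper_values s).
Proof.
have [C C0 hC] := reward_bound r; exists (- C) => _ [y [P UP hy] <-].
have [a0 _] : exists a : A, a \in A by apply/existsP; rewrite -lt0n (actions_nonempty M).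
apply: le_trans (average_le_guarantee [ffun=> a0] UP hy s).
exact: average_ge_reward_bound.
Qed.

Let g_le P y : uncertainty M P -> guarantees P y -> forall s, g s <= y s.
Proof.
by move=> UP hy s; apply: ge_inf => //; exists y => //; exists P.
Qed.

(** Rectangularity lets nature choose its kernel separately at each state-action pair. *)
Let U_select (I : finType) (F : I -> transition R S A) (sigma : {ffun S * A -> I}) :
  (forall i, uncertainty M (F i)) ->
  uncertainty M (fun s a => F (sigma (s, a)) s a).
Proof. by move=> UF; apply/UE => s a; have /UE := UF (sigma (s, a)). Qed.

Let upper_nonempty s : upper_values s !=set0.
Proof.
have [P UP] := uncertainty_nonempty M.
have [sigma [pi [y [hy _ _]]]] := @finite_family_saddle unit tt (fun=> P) (fun=> UP).
by exists (y s), y => //; exists P.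
Qed.

(** The kernel depends on [s]: the pointwise infimum [g] need not be approached by one kernel at all
    states at once. *)
Let g_approx (e : R) s : 0 < e ->
  exists P y, [/\ uncertainty M P, guarantees P y & y s < g s + e].
Proof.
move=> e0.
have hi : has_inf (upper_values s) by split; [exact: upper_nonempty|exact: upper_lbound].
by have [_ [y [P UP hy] <-] lt_y] := inf_adherent e0 hi; exists P, y.
Qed.

(* A saddle of the finite game containing a counterexample for each policy
   and a nearly optimal kernel for each state contradicts one of these. *)
Lemma saddle_policy : exists pi : {ffun S -> A},
  (forall P, uncertainty M P -> forall s, g s <= avg pi P s) /\
  (forall P, uncertainty M P -> forall s, g s <= mean (P s (pi s)) g).
Proof.
apply: contrapT => /forallNP none.
have bad pi : exists t : transition R S A * S * R, [/\ uncertainty M t.1.1, 0 < t.2 &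
    avg pi t.1.1 t.1.2 <= g t.1.2 - t.2 \/
    mean (t.1.1 t.1.2 (pi t.1.2)) g <= g t.1.2 - t.2].
  apply: contrapT => /forallNP nobad; apply: (none pi).
  split=> P UP s; rewrite leNgt; apply/negP => lt_g.
    apply: (nobad (P, s, g s - avg pi P s)); split=> //=; first by rewrite subr_gt0.
    by left; rewrite subKr.
  apply: (nobad (P, s, g s - mean (P s (pi s)) g)).
  split=> //=; first by rewrite subr_gt0.
  by right; rewrite subKr.
have /choice[t ht] := bad.
have [a0 _] : exists a : A, a \in A by apply/existsP; rewrite -lt0n (actions_nonempty M).
(* Among finitely many policies, [pim] has the smallest violation, so [e] is a margin common to all
   of them. *)
have [pim hpim] := exists_max (fun pi => - (t pi).2) [ffun=> a0].
set e := (t pim).2 in hpim; have e0 : 0 < e by rewrite /e; case: (ht pim).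
have e2 : 0 < e / 2 by rewrite divr_gt0.
have /choice[w hw] s : exists w : transition R S A * (S -> R),
    [/\ uncertainty M w.1, guarantees w.1 w.2 & w.2 s < g s + e / 2].
  by have [P [y h]] := g_approx s e2; exists (P, y).
pose F (i : {ffun S -> A} + S) :=
  match i with inl pi => (t pi).1.1 | inr s => (w s).1 end.
have UF i : uncertainty M (F i).
  by case: i => [pi|s] /=; [case: (ht pi)|case: (hw s)].
have [sigma [pi [y [hy yavg ymean]]]] := finite_family_saddle (inl pim) UF.
have gy := g_le (U_select sigma UF) hy.
(* The saddle value is at most the gain of [pi] against the kernel [w s], which is nearly optimal at
   [s]. *)
have yg s : y s <= g s + e / 2.
  have [Uw hgw lt_w] := hw s; apply: le_trans (ltW lt_w).
  by apply: le_trans (yavg (inr s) s) _; exact: average_le_guarantee.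
(* The counterexample chosen for the saddle policy [pi] belongs to the finite game. As
   [g <= y <= g + e / 2], a violation by at least [e] is impossible in either case. *)
have [UP _ hbad] := ht pi; have := hpim pi; rewrite lerN2 => he.
case: hbad; set s := (t pi).1.2 => hbad.
  by have := yavg (inl pi) s; have := gy s; rewrite /F; lra.
have := ymean (inl pi) s; rewrite /F.
have : mean ((t pi).1.1 s (pi s)) y <=
    mean ((t pi).1.1 s (pi s)) (fun s' => 1 * g s' + e / 2).
  by apply: ler_mean => [|s']; [exact: U_simplex|rewrite mul1r].
rewrite mean_affine; last exact: U_simplex.
by have := gy s; lra.
Qed.

(** A guarantee bounds the gain of all policies against its kernel, hence their worst-case gains;
    the policy of [saddle_policy] attains [g]. *)
Lemma optimal_gainE s : optimal_gain M s = g s.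
Proof.
have [C C0 hC] := reward_bound r.
have [a0 _] : exists a : A, a \in A by apply/existsP; rewrite -lt0n (actions_nonempty M).
have [P0 UP0] := uncertainty_nonempty M.
have lbd pi : has_lbound [set avg pi P s | P in uncertainty M].
  by exists (- C) => _ [P UP <-]; exact: average_ge_reward_bound.
apply/eqP; rewrite eq_le; apply/andP; split.
  apply: ge_sup => [|_ [pi _ <-]]; first by eexists; exists [ffun=> a0].
  apply: lb_le_inf => // _ [y [P UP hy] <-].
  apply: le_trans (average_le_guarantee pi UP hy s).
  by apply: ge_inf; [exact: lbd|exists P].
have [pi [hpi _]] := saddle_policy.
apply: (@le_trans _ _ (inf [set avg pi P s | P in uncertainty M])).
  apply: lb_le_inf => [|_ [P UP <-]]; first by exists (avg pi P0 s), P0.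
  exact: hpi.
apply: ub_le_sup; last by exists pi.
have [B _ hB] := finite_normr_bound (fun pi => inf [set avg pi P s | P in uncertainty M]).
by exists B => _ [pi' _ <-]; exact: le_trans (ler_norm _) (hB pi').
Qed.

Let ultra_cvg_uncertainty (U : set_system nat) (P : nat -> transition R S A) :
  UltraFilter U -> (forall n, uncertainty M (P n)) ->
  exists2 Q, uncertainty M Q &
    forall s a s', P n s a s' @[n --> U] --> Q s a s'.
Proof.
move=> hU UP.
have [|_ [Q UQ <-] hQ] := @ultra_cvg_compact U hU _ _ (fun n => coords (P n))
  (@uncertainty_compact _ _ _ M); first by move=> n; exists (P n).
exists Q => // s a s'.
have coordE (P' : transition R S A) :
    P' s a s' = coords P' 0 (enum_rank (s, a, s')).
  by rewrite mxE enum_rankK.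
rewrite coordE (_ : (fun n => _) =
  (fun v : 'rV[R]_#|{: S * A * S}| => v 0 (enum_rank (s, a, s'))) \o
  (fun n => coords (P n))); last by apply/funext => n; rewrite /= coordE.
by apply: cvg_comp hQ _; exact: coord_continuous.
Qed.

(* x n is the value of the game discounted by gam n where the nature plays
   against pi, and Q its limit of nearly optimal kernels, with potential h. At a
   state maximizing f - x n + (1 - gam n) h, the optimality inequality for x n
   gives f - x n <= f - (mean reward + mean h) + h + o(1), whose right-hand side
   tends to f minus the gain of Q. *)
Lemma subharmonic_certificate (pi : {ffun S -> A}) (f : S -> R) :
  (forall P, uncertainty M P -> forall s, f s <= avg pi P s) ->
  (forall P, uncertainty M P -> forall s, f s <= mean (P s (pi s)) f) ->
  forall e : R, 0 < e -> exists h : S -> R,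
    forall P, uncertainty M P -> forall s,
      f s - e + h s <= mean (P s (pi s)) (r s (pi s)) + mean (P s (pi s)) h.
Proof.
move=> favg fmean e e0.
(* With [pi] fixed, the maximizing player has a single action. *)
pose r1 (s : S) (_ : unit) := r s (pi s).
pose K1 (s : S) (_ : unit) := Usa s (pi s).
have K0 s a : K1 s a !=set0 by exact: Usa_nonempty.
have KS s a : K1 s a `<=` @simplex R S by exact: Usa_simplex.
have A0 : (0 < #|{: unit}|)%N by rewrite card_unit.
have [C C0 hC] := reward_bound r; have hC1 s a s' : `|r1 s a s'| <= C by exact: hC.
have [P0 UP0] := uncertainty_nonempty M.
(* The slack is of second order in [1 - gam n], so it still vanishes after division by
   [1 - gam n]. *)
have disc n : exists t : (S -> R) * transition R S A,
    [/\ forall s, `|t.1 s| <= C, uncertainty M t.2,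
      forall P s, uncertainty M P ->
        t.1 s <= q_value r (gam n) t.1 s (pi s) (P s (pi s)) &
      forall s, q_value r (gam n) t.1 s (pi s) (t.2 s (pi s)) <=
        t.1 s + harmonic n * harmonic n].
  have /andP[g0 /ltW g1] := gam_lt1 n.
  have g01 : 0 <= gam n <= 1 by rewrite g0 g1.
  have [x [hx xC]] := bellman_fixpoint A0 K0 KS g01 C0 hC1.
  have hh : 0 < harmonic n * harmonic n :> R by rewrite mulr_gt0 ?harmonic_gt0.
  have /choice[p hp] s : exists p, Usa s (pi s) p /\
      q_value r (gam n) x s (pi s) p <= x s + harmonic n * harmonic n.
    have [p hp /ltW] := bellman_q_lt r1 A0 K0 KS (gam n) x s tt hh.
    by rewrite hx => ?; exists p.
  (* Off the actions of [pi] any admissible kernel will do; [P0] keeps the whole in the uncertainty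
     set. *)
  exists (x, fun s a => if a == pi s then p s else P0 s a); split=> //=.
  - apply/UE => s a; case: eqP => [->|_]; first by have [] := hp s.
    by move/UE: UP0.
  - move=> P s /UE UP; rewrite -[leLHS]hx.
    by have [[] hle] := bellman_le_q r1 A0 K0 KS (gam n) x s; apply: hle.
  - by move=> s; rewrite eqxx; have [] := hp s.
have /choice[t ht] := disc.
have [U [hU sU]] := ultra_ge_infty.
have /choice[v hv] s : exists l : R, (t n).1 s @[n --> U] --> l.
  by apply: (@ultra_cvg_bounded _ hU _ _ C) => n; case: (ht n).
have [n|Q UQ hQ] := @ultra_cvg_uncertainty U (fun n => (t n).2) hU.
  by case: (ht n).
have hQS s : simplex (Q s (pi s)) by exact: U_simplex.
have [gQ [h [hgQ hhQ]]] := poisson (fun s => mean (Q s (pi s)) (r s (pi s))) hQS.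
have avgQ := long_run_average_poisson (U_simplex UQ) hgQ hhQ.
have f_le_v s : f s <= v s.
  pose y n s := f s - (t n).1 s + harmonic n * h s.
  have cvg_y s' : y n s' @[n --> U] --> f s' - v s'.
    rewrite -[X in _ --> X]addr0; apply: cvgD; last exact: cvg_harmonicM.
    by apply: cvgB; [exact: cvg_cst|exact: hv].
  have /choice[m hm] n := exists_max (y n) s.
  (* The maximizers lie in a finite set, so one state [s0] serves along the ultrafilter. *)
  have [s0 hs0] := ultra_finite hU m.
  have ys0 : f s - v s <= f s0 - v s0.
    apply: (ler_cvg_to (cvg_y s) (cvg_y s0)).
    by near=> n; have <- : m n = s0 by near: n.
  suff : f s0 - v s0 <= 0 by lra.
  have lim : f s0 + harmonic n * 1 - mean ((t n).2 s0 (pi s0)) (r s0 (pi s0)) -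
      (1 - harmonic n * 1) * mean ((t n).2 s0 (pi s0)) h + h s0 @[n --> U] -->
      f s0 + 0 - mean (Q s0 (pi s0)) (r s0 (pi s0)) -
      (1 - 0) * mean (Q s0 (pi s0)) h + h s0.
    have c0 : harmonic n * 1 @[n --> U] --> (0 : R) by exact: cvg_harmonicM.
    apply: cvgD; last exact: cvg_cst.
    apply: cvgB; last first.
      apply: cvgM; first by apply: cvgB => //; exact: cvg_cst.
      by apply: cvg_mean => // s'; exact: cvg_cst.
    apply: cvgB; first by apply: cvgD => //; exact: cvg_cst.
    by apply: cvg_mean => // s'; exact: cvg_cst.
  have : f s0 - v s0 <= f s0 + 0 - mean (Q s0 (pi s0)) (r s0 (pi s0)) -
      (1 - 0) * mean (Q s0 (pi s0)) h + h s0.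
    apply: (ler_cvg_to (cvg_y s0) lim); near=> n.
    have mn : m n = s0 by near: n.
    have [_ UPn _ /(_ s0)] := ht n.
    set p := (t n).2 s0 (pi s0); set x := (t n).1; rewrite q_valueE subr_gam.
    have hp : simplex p by exact: U_simplex.
    have : mean p (y n) <= y n s0 by apply: mean_le_cst => // s'; rewrite -mn.
    have -> : mean p (y n) = mean p f - mean p x + harmonic n * mean p h.
      transitivity (mean p (fun s' => 1 * (1 * f s' + -1 * x s') + harmonic n * h s')).
        by apply: eq_mean => s'; rewrite /y -/x; ring.
      by rewrite !mean_lin; ring.
    have := fmean _ UPn s0; rewrite -/p => fp hy hq.
    have /andP[g0 _] := gam_lt1 n; have l0 := harmonic_gt0 n : 0 < harmonic n :> R.
    (* Maximality at [s0] and [fmean] are weighted by [gam n] and added to the near-optimality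
       inequality: the terms in [mean p f] and [mean p x] cancel. *)
    rewrite -(ler_pM2l l0); move: hy hq; rewrite /y -/x => hy.
    have := ler_wpM2l g0 hy; have := ler_wpM2l g0 fp.
    by rewrite /gam; lra.
  by have := favg _ UQ s0; rewrite /avg avgQ; have := hhQ s0; lra.
have near_v : \forall n \near U, forall s, v s - e <= (t n).1 s.
  by apply: filter_forall => s; apply: (cvgr_ge _ (hv s)); rewrite gtrBl.
have [n hn] := filter_ex near_v.
exists (fun s => gam n / (1 - gam n) * (t n).1 s) => P UP s.
have /andP[_ g1] := gam_lt1 n.
have := q_value_gap r (t n).1 s (pi s) (P s (pi s)) g1.
have : 0 <= (q_value r (gam n) (t n).1 s (pi s) (P s (pi s)) - (t n).1 s) /
    (1 - gam n).
  rewrite divr_ge0 ?subr_ge0 ?(ltW g1) //.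
  by have [_ _ hle _] := ht n; exact: hle.
by have := hn s; have := f_le_v s; lra.
Unshelve. all: by end_near. Qed.

(** * Convergence of value iteration *)

Variables omega gamma : nat -> R.
Hypothesis omega_ge0 : forall t, 0 <= omega t.
Hypothesis omega_incr : forall t, omega t < omega t.+1.
Hypothesis omega_infty : omega t @[t --> \oo] --> +oo.
Hypothesis omega_ratio : omega t / omega t.+1 @[t --> \oo] --> (1 : R).
Hypothesis gammaE : forall t, gamma t = omega t / omega t.+1.
Hypothesis gamma_incr : forall t, gamma t <= gamma t.+1.

Let v := value_iteration M Usa gamma.

Let omegaS_gt0 t : 0 < omega t.+1.
Proof. exact: le_lt_trans (omega_ge0 t) (omega_incr t). Qed.

Let gamma01 t : 0 <= gamma t <= 1.
Proof.
rewrite gammaE divr_ge0 ?(ltW (omegaS_gt0 _)) //= ler_pdivrMr // mul1r.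
exact: ltW.
Qed.

Let near_small (h : S -> R) (e : R) : 0 < e ->
  exists N, forall t, (N <= t)%N -> forall s, `|(1 - gamma t) * h s| <= e.
Proof.
move=> e0; have [C C0 hC] := finite_normr_bound h.
have : (1 - gamma t) * C @[t --> \oo] --> (1 - 1) * C.
  apply: cvgMl; apply: cvgB; first exact: cvg_cst.
  by rewrite (_ : gamma = fun t => omega t / omega t.+1) //; exact/funext.
rewrite subrr mul0r => /cvgr_le /(_ _ e0)[N _ hN]; exists N => t Nt s.
apply: le_trans (hN t Nt); have /andP[_ g1] := gamma01 t.
by rewrite normrM ger0_norm ?subr_ge0 // ler_wpM2l ?subr_ge0.
Qed.

Let near_div_omega (B e : R) : 0 < e -> \forall t \near \oo, B / omega t.+1 <= e.
Proof.
move=> e0; have /cvgryPge /(_ (B / e)) : omega t.+1 @[t --> \oo] --> +oo.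
  by rewrite (cvg_shiftS omega).
apply: filterS => t ht.
by rewrite ler_pdivrMr // mulrC -ler_pdivrMr.
Qed.

(* With x the supersolution below, max_s omega t * (v t s - x t s) does not
   increase while positive, since gamma t * omega t.+1 = omega t. *)
Let value_upper P y : uncertainty M P -> guarantees P y ->
  forall e : R, 0 < e -> forall s, \forall t \near \oo, v t s <= y s + e.
Proof.
move=> UP [hy hh] e e0 s; have e3 : 0 < e / 3 by rewrite divr_gt0.
have [h0 hh0] := hh _ e3; have [C C0 hC] := finite_normr_bound h0.
(* A certificate is unchanged by adding a constant to its potential. With [h <= 0], the term
   [(1 - gamma t) * h] is nondecreasing in t, so supersolutions may move to the next step. *)
pose h s := 1 * h0 s + - C.
have h_le0 s' : h s' <= 0.
  by have := hC s'; rewrite ler_norml /h => /andP[*]; lra.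
have hh' s' a : mean (P s' a) (r s' a) + mean (P s' a) h <= y s' + e / 3 + h s'.
  rewrite mean_affine; last exact: U_simplex.
  by have := hh0 s' a; rewrite /h; lra.
have [N hN] := near_small h e3.
pose x t s := y s + (e / 3 + e / 3) + (1 - gamma t) * h s.
(* Starting at [N.+1] makes the weight positive: [omega 0] may be zero. *)
pose D s := omega N.+1 * (v N.+1 s - x N.+1 s).
have [B B0 hB] := finite_normr_bound D.
have ind k s' : v (N + k).+1 s' <= x (N + k).+1 s' + B / omega (N + k).+1.
  elim: k s' => [|k IH] s'; rewrite ?addn0 ?addnS.
    rewrite -lerBlDl ler_pdivlMr // mulrC; apply: le_trans (ler_norm _) _.
    exact: hB.
  move: IH; set t := (N + k)%N => IH.
  have /andP[g0 g1] := gamma01 t.+1.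
  rewrite [v t.+2]/(bellman r Usa (gamma t.+1) (v t.+1)).
  apply: (bellman_le (actions_nonempty M) Usa_nonempty Usa_simplex) => a.
  exists (P s' a); first by move/UE: UP.
  apply: le_trans (ler_q_value r s' a g0 (U_simplex UP s' a) IH) _.
  rewrite q_value_shift; last exact: U_simplex.
  have -> : gamma t.+1 * (B / omega t.+1) = B / omega t.+2.
    by rewrite gammaE; field; rewrite !gt_eqF.
  rewrite lerD2r; apply: le_trans (q_value_potential_le (U_simplex UP s' a) _ _ _ _) _.
  - exact: gamma01.
  - exact: hy.
  - exact: hh'.
  - by apply: hN; exact: leqW (leq_addr _ _).
  rewrite lerD2l; have := h_le0 s'; have := gamma_incr t.+1; nra.
apply: near_inftyS.
near=> t; have Nt : (N <= t)%N by near: t; exact: nbhs_infty_ge.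
rewrite -(subnKC Nt); apply: le_trans (ind _ s) _; rewrite subnKC //.
have h1 : B / omega t.+1 <= e / 3 by near: t; exact: near_div_omega.
have /andP[_ g1] := gamma01 t.+1; rewrite /x.
have := h_le0 s; nra.
Unshelve. all: by end_near. Qed.

(** Playing [pi] at each step bounds the Bellman maximum from below, and the certificate makes [x]
    below a subsolution. The potential is now shifted to be nonnegative, so that [(1 - gamma t) * h]
    is nonincreasing. *)
Let value_lower (pi : {ffun S -> A}) (f : S -> R) :
  (forall P, uncertainty M P -> forall s, f s <= mean (P s (pi s)) f) ->
  (forall e : R, 0 < e -> exists h : S -> R,
    forall P, uncertainty M P -> forall s,
      f s - e + h s <= mean (P s (pi s)) (r s (pi s)) + mean (P s (pi s)) h) ->
  forall e : R, 0 < e -> forall s, \forall t \near \oo, f s - e <= v t s.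
Proof.
move=> hf hh e e0 s; have e3 : 0 < e / 3 by rewrite divr_gt0.
have [h0 hh0] := hh _ e3; have [C C0 hC] := finite_normr_bound h0.
pose h s := 1 * h0 s + C.
have h_ge0 s' : 0 <= h s'.
  by have := hC s'; rewrite ler_norml /h => /andP[*]; lra.
have hh' P s' : uncertainty M P -> f s' - e / 3 + h s' <=
    mean (P s' (pi s')) (r s' (pi s')) + mean (P s' (pi s')) h.
  move=> UP; rewrite mean_affine; last exact: U_simplex.
  by have := hh0 P UP s'; rewrite /h; lra.
have [N hN] := near_small h e3.
pose x t s := f s - (e / 3 + e / 3) + (1 - gamma t) * h s.
pose D s := omega N.+1 * (x N.+1 s - v N.+1 s).
have [B B0 hB] := finite_normr_bound D.
have ind k s' : x (N + k).+1 s' - B / omega (N + k).+1 <= v (N + k).+1 s'.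
  elim: k s' => [|k IH] s'; rewrite ?addn0 ?addnS.
    rewrite lerBlDl -lerBlDr ler_pdivlMr // mulrC; apply: le_trans (ler_norm _) _.
    exact: hB.
  move: IH; set t := (N + k)%N => IH.
  have /andP[g0 g1] := gamma01 t.+1.
  rewrite [v t.+2]/(bellman r Usa (gamma t.+1) (v t.+1)).
  apply: (bellman_ge (actions_nonempty M) Usa_nonempty Usa_simplex (a := pi s')) => p hp.
  (* By rectangularity, [p] extends to a full admissible kernel, to which the certificate
     applies. *)
  have [P UP Pp] : exists2 P, uncertainty M P & P s' (pi s') = p.
    have [P0 /UE UP0] := uncertainty_nonempty M.
    exists (fun s1 a1 => if (s1, a1) == (s', pi s') then p else P0 s1 a1).
      by apply/UE => s1 a1; case: eqP => [[-> ->]|_].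
    by rewrite eqxx.
  rewrite -Pp.
  apply: le_trans (ler_q_value r s' (pi s') g0 (U_simplex UP s' (pi s')) IH).
  rewrite q_value_shift; last exact: U_simplex.
  have -> : gamma t.+1 * - (B / omega t.+1) = - (B / omega t.+2).
    by rewrite gammaE; field; rewrite !gt_eqF.
  rewrite lerD2r; apply: le_trans (q_value_potential_ge (U_simplex UP s' (pi s')) _ _ _ _).
  - by rewrite lerD2l; have := h_ge0 s'; have := gamma_incr t.+1; nra.
  - exact: gamma01.
  - exact: hf.
  - exact: hh'.
  - by apply: hN; exact: leqW (leq_addr _ _).
apply: near_inftyS.
near=> t; have Nt : (N <= t)%N by near: t; exact: nbhs_infty_ge.
rewrite -(subnKC Nt); apply: le_trans (ind _ s); rewrite subnKC //.
have h1 : B / omega t.+1 <= e / 3 by near: t; exact: near_div_omega.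
have /andP[_ g1] := gamma01 t.+1; rewrite /x.
have := h_ge0 s; nra.
Unshelve. all: by end_near. Qed.

Lemma value_iteration_cvg s : v t s @[t --> \oo] --> optimal_gain M s.
Proof.
rewrite optimal_gainE; apply/cvgrPdist_le => e e0.
have e2 : 0 < e / 2 by rewrite divr_gt0.
(* From above, a guarantee close to [g] at the state [s] alone is enough; from below, [g] itself has
   a certificate at all states. *)
have [P [y [UP hy ltg]]] := g_approx s e2.
have [pi [hpi hpig]] := saddle_policy.
have cert := subharmonic_certificate hpi hpig.
near=> t; have h1 : v t s <= y s + e / 2 by near: t; exact: value_upper UP hy _ e2 s.
have h2 : g s - e <= v t s by near: t; exact: (value_lower hpig cert).
by rewrite ler_norml; apply/andP; split; lra.
Unshelve. all: by end_near. Qed.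
End Gain.

Theorem theorem5p3 (R : realType) (S A : finType) (M : rmdp R S A)
    (Usa : S -> A -> set (S -> R))
    (hrect : sa_rectangular (uncertainty M) Usa)
    (hdef : exp_definable (@coords R S A @` uncertainty M))
    (omega gamma : nat -> R)
    (homega_ge0 : forall t, 0 <= omega t)
    (homega_incr : forall t, omega t < omega t.+1)
    (homega_infty : omega t @[t --> \oo] --> +oo)
    (homega_ratio : omega t / omega t.+1 @[t --> \oo] --> (1 : R))
    (hgamma : forall t, gamma t = omega t / omega t.+1)
    (hgamma_incr : forall t, gamma t <= gamma t.+1) :
  forall s : S,
    value_iteration M Usa gamma t s @[t --> \oo] --> optimal_gain M s.
Proof. by move=> s; apply: value_iteration_cvg. Qed.
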